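(* Let $M$ be a manifold of dimension $n\ge2$. For any cone triple $(\Omega,T,F)$ of a cone structure $\mathcal C$ on $M$, the continuous two-homogeneous function $G:TM\to\mathbb R$, $$G(tT_p+w_p)=t^2-F(w_p)^2,\qquad\forall t\in\mathbb R,\ \forall w_p\in\ker(\Omega_p),\ \forall p\in M,$$ is smooth everywhere but on $\mathrm{span}(T)$ (i.e., it is smooth on $TM\setminus\mathrm{span}(T)$). Moreover, whenever it is smooth, its fundamental tensor $g_v(u,w)=\frac12\frac{\partial^2}{\partial r\partial s}G(v+ru+sw)|_{r=s=0}$ is non-degenerate with index $n-1$.
   Context: ''Smooth'' means $C^\infty$. A cone triple $(\Omega,T,F)$ on $M$ consists of a non-vanishing 1-form $\Omega$, a vector field $T$ with $\Omega(T)\equiv1$, and a Finsler metric $F$ on the bundle $\ker\Omega$, i.e., a continuous function $F:\ker\Omega\to[0,\infty)$, positive and smooth away from the zero section, with $F(\lambda v)=\lambda F(v)$ for $\lambda>0$ and such that $\frac12\frac{\partial^2}{\partial r\partial s}F^2(v+ru+sw)|_{r=s=0}$ is positive definite for all $v\ne0$. Its cone structure is $\mathcal C=\{F(w_p)T_p+w_p: w_p\in\ker\Omega_p\setminus\{0\},\ p\in M\}$. $\mathrm{span}(T)=\{tT_p:t\in\mathbb R,p\in M\}$. Index $n-1$ means signature $(+,-,\dots,-)$. *)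

(* Defs.v *)
From HB Require Import structures.
From mathcomp Require Import all_boot all_order all_algebra.
From mathcomp Require Import all_classical all_reals all_analysis.

Set Implicit Arguments.
Unset Strict Implicit.
Unset Printing Implicit Defensive.

Import Order.TTheory GRing.Theory Num.Theory.
Import numFieldNormedType.Exports.

Local Open Scope classical_set_scope.
Local Open Scope ring_scope.

Section Euclidean.
Context {R : realType} {V W : normedModType R}.

(* Class C^k on an open set U, for V finite-dimensional: every directional
   derivative is again of class C^(k-1). *)
Fixpoint Ck (k : nat) (U : set V) (f : V -> W) : Prop :=
  match k with
  | 0 => forall x, U x -> {for x, continuous f}
  | k'.+1 => (forall x, U x -> differentiable f x) /\
             forall v : V, Ck k' U (fun x => 'd f x v)
  end.

Definition smooth (U : set V) (f : V -> W) : Prop := forall k, Ck k U f.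

End Euclidean.

(* A smooth n-manifold is given by a smooth atlas, not necessarily maximal:
   [chart i] matters on [dom i] only, [chart_inv i] on [codom_of i] only. *)
Record smoothManifold (R : realType) (n : nat) := SmoothManifold {
  carrier :> topologicalType ;
  manifold_hausdorff : hausdorff_space carrier ;
  manifold_second_countable : @second_countable carrier ;
  chart_index : Type ;
  dom : chart_index -> set carrier ;
  chart : chart_index -> carrier -> 'rV[R]_n ;
  chart_inv : chart_index -> 'rV[R]_n -> carrier ;
  dom_open : forall i, open (dom i) ;
  dom_cover : forall p, exists i, dom i p ;
  codom_open : forall i, open (chart i @` dom i) ;
  chartK : forall i p, dom i p -> chart_inv i (chart i p) = p ;
  chart_continuous : forall i, {within dom i, continuous (chart i)} ;
  chart_inv_continuous : forall i,
    {within chart i @` dom i, continuous (chart_inv i)} ;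
  transition_smooth : forall i j,
    smooth (chart i @` (dom i `&` dom j)) (chart j \o chart_inv i)
}.

Section TangentBundle.
Context {R : realType} {n : nat} {M : smoothManifold R n}.

Definition codom_of (i : chart_index M) : set 'rV[R]_n := chart i @` dom i.

Definition chart_at (p : M) : chart_index M := projT1 (cid (dom_cover p)).

(* A tangent vector at p is represented by its coordinates in the chosen chart
   [chart_at p]; [dchart i p] gives its coordinates in an arbitrary chart i at
   p, by the usual transformation rule. *)
Definition tangent (p : M) : Type := 'rV[R]_n.

Definition dchart (i : chart_index M) (p : M) (v : tangent p) : 'rV[R]_n :=
  'd (chart i \o chart_inv (chart_at p)) (chart (chart_at p) p) v.

Definition dchart_inv (i : chart_index M) (p : M) (y : 'rV[R]_n) : tangent p :=
  'd (chart (chart_at p) \o chart_inv i) (chart i p) y.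


Definition TM : Type := {p : M & tangent p}.

Definition tvec (p : M) (v : tangent p) : TM := existT _ p v.

Arguments tvec : clear implicits.

Definition Tdom (i : chart_index M) : set TM := [set v | dom i (projT1 v)].

Definition Tchart (i : chart_index M) (v : TM) : 'rV[R]_n * 'rV[R]_n :=
  (chart i (projT1 v), dchart i (projT2 v)).

Definition Tchart_inv (i : chart_index M) (z : 'rV[R]_n * 'rV[R]_n) : TM :=
  tvec _ (dchart_inv i (chart_inv i z.1) z.2).

Definition Tcodom (i : chart_index M) : set ('rV[R]_n * 'rV[R]_n) :=
  [set z | codom_of i z.1].

(* The topology and the smooth structure of TM are those given by the charts
   [Tchart i : Tdom i -> Tcodom i]. *)

Definition TM_continuous_on (S : set TM) (f : TM -> R) : Prop :=
  forall i, {within Tcodom i `&` Tchart_inv i @^-1` S,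
              continuous (f \o Tchart_inv i)}.

(* f is smooth on some neighborhood of v in TM *)
Definition TM_smooth_at (v : TM) (f : TM -> R) : Prop :=
  forall i, Tdom i v ->
    exists2 O, open_nbhs (Tchart i v) O & smooth O (f \o Tchart_inv i).

(* Smoothness of f along a subset S (here an embedded submanifold) of TM:
   near each point of S, f coincides on S with a smooth function on TM. *)
Definition TM_smooth_on (S : set TM) (f : TM -> R) : Prop :=
  forall v, S v -> forall i, Tdom i v ->
    exists O : set ('rV[R]_n * 'rV[R]_n),
    exists g : 'rV[R]_n * 'rV[R]_n -> R,
    [/\ open_nbhs (Tchart i v) O, smooth O g &
        forall z, O z -> Tcodom i z -> S (Tchart_inv i z) ->
          g z = f (Tchart_inv i z)].

Definition smooth_vector_field (T : forall p : M, tangent p) : Prop :=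
  forall i, smooth (codom_of i) (fun x => dchart i (T (chart_inv i x))).

Definition smooth_one_form (Om : forall p : M, {scalar tangent p}) : Prop :=
  forall i (y : 'rV[R]_n),
    smooth (codom_of i)
      (fun x => Om (chart_inv i x) (dchart_inv i (chart_inv i x) y) : R).

(* g_v(u, w) = (1/2) d^2/drds L(v + r u + s w) at r = s = 0 *)
Definition fundamental_tensor (L : TM -> R) (p : M) (v u w : tangent p) : R :=
  2^-1 * derive1 (fun r : R =>
           derive1 (fun s : R => L (tvec p (v + r *: u + s *: w))) 0) 0.

Definition ker_form (Om : forall p : M, {scalar tangent p}) : set TM :=
  [set v | Om (projT1 v) (projT2 v) = 0].

Definition slit_ker_form (Om : forall p : M, {scalar tangent p}) : set TM :=
  [set v | Om (projT1 v) (projT2 v) = 0 /\ projT2 v != 0 :> 'rV[R]_n].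

Arguments fundamental_tensor : clear implicits.

(* F is a total function on TM, but only its values on ker Om matter. *)
Record finsler_metric (Om : forall p : M, {scalar tangent p}) (F : TM -> R) :
    Prop := FinslerMetric {
  finsler_ge0 : forall v, ker_form Om v -> 0 <= F v ;
  finsler_gt0 : forall v, slit_ker_form Om v -> 0 < F v ;
  finsler_continuous : TM_continuous_on (ker_form Om) F ;
  finsler_smooth : TM_smooth_on (slit_ker_form Om) F ;
  finsler_homogeneous : forall (p : M) (v : tangent p) (l : R),
    Om p v = 0 -> 0 < l -> F (tvec p (l *: v)) = l * F (tvec p v) ;
  finsler_convex : forall (p : M) (v u : tangent p),
    Om p v = 0 -> v != 0 -> Om p u = 0 -> u != 0 ->
    0 < fundamental_tensor (fun x => F x ^+ 2) p v u u
}.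

Record cone_triple (Om : forall p : M, {scalar tangent p})
    (T : forall p : M, tangent p) (F : TM -> R) : Prop := ConeTriple {
  triple_form_smooth : smooth_one_form Om ;
  triple_form_nonvanishing : forall p, exists v, Om p v != 0 ;
  triple_field_smooth : smooth_vector_field T ;
  triple_normalized : forall p, Om p (T p) = 1 ;
  triple_finsler : finsler_metric Om F
}.

Definition cone_structure (Om : forall p : M, {scalar tangent p})
    (T : forall p : M, tangent p) (F : TM -> R) : set TM :=
  [set v | exists p (w : tangent p), [/\ Om p w = 0, w != 0 &
           v = tvec p (F (tvec p w) *: T p + w)]].

Definition span_field (T : forall p : M, tangent p) : set TM :=
  [set v | exists p (t : R), v = tvec p (t *: T p)].

Definition cone_function (Om : forall p : M, {scalar tangent p})
    (T : forall p : M, tangent p) (F : TM -> R) (G : TM -> R) : Prop :=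
  forall (p : M) (t : R) (w : tangent p), Om p w = 0 ->
    G (tvec p (t *: T p + w)) = t ^+ 2 - F (tvec p w) ^+ 2.

Definition two_homogeneous (G : TM -> R) : Prop :=
  forall (p : M) (v : tangent p) (l : R), 0 < l ->
    G (tvec p (l *: v)) = l ^+ 2 * G (tvec p v).

End TangentBundle.

Arguments TM {R n} M.
Arguments tvec {R n M} p v.
Arguments fundamental_tensor {R n M} L p v u w.

Section BilinearForms.
Context {R : realType} {V : vectType R}.

Definition symmetric_bilinear (g : V -> V -> R) : Prop :=
  (forall u w, g u w = g w u) /\
  (forall (a : R) u u' w, g (a *: u + u') w = a * g u w + g u' w).

Definition nondegenerate_form (g : V -> V -> R) : Prop :=
  forall u, (forall w, g u w = 0) -> u = 0.

(* Signature (+,-,...,-) in dimension n. *)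
Definition lorentzian_signature (n : nat) (g : V -> V -> R) : Prop :=
  exists2 e : n.-tuple V, basis_of fullv e &
    forall i j : 'I_n, g (tnth e i) (tnth e j) =
      if i == j then (if i == 0%N :> nat then 1 else -1) else 0.

End BilinearForms.

(* Main.v *)
(* In a chart the projection v - Om(v) T onto ker Om is a smooth map, and
   G(v) = Om(v)^2 - F(v - Om(v) T)^2; this gives existence, uniqueness,
   continuity and smoothness off span(T).  Where G is smooth, its Hessian is
   symmetric, T is a unit vector orthogonal to ker Om, and on ker Om the tensor
   is minus that of F^2, hence negative definite.  At a point of span(T) the
   convexity of F is not available: there, along a kernel direction w,
   s |-> G(v + s w) equals Om(v)^2 - s^2 F(w)^2 for s >= 0 by homogeneity, so
   the Hessian, which exists by assumption, takes the value -F(w)^2 < 0 at w.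
   Gram-Schmidt then yields the Lorentzian basis. *)
Require Import Defs.
From HB Require Import structures.
From mathcomp Require Import all_boot all_order all_algebra.
From mathcomp Require Import all_classical all_reals all_analysis.
From mathcomp Require Import ring.

Set Implicit Arguments.
Unset Strict Implicit.
Unset Printing Implicit Defensive.

Import Order.TTheory GRing.Theory Num.Theory.
Import numFieldNormedType.Exports.

Local Open Scope classical_set_scope.
Local Open Scope ring_scope.

(** * Calculus of C^k maps *)

Section CkCalculus.
Context {R : realType}.
Implicit Types V W : normedModType R.

(** The first-order expansion of [f] at [x] only sees values near [x], so it is also one of [g];
    uniqueness of the differential concludes. *)
Lemma near_eq_diff V W (f g : V -> W) x :
  (\forall y \near x, f y = g y) -> differentiable f x ->
  differentiable g x /\ 'd g x = 'd f x :> (V -> W).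
Proof.
move=> fg df; have fgx := nbhs_singleton fg.
have dg : g \o shift x = cst (g x) + 'd f x +o_ 0 id.
  apply/eqaddoP => e e0.
  have /eqaddoP /(_ e e0) := diff_locally df.
  have fg0 : \forall y \near (0 : V), f (y + x) = g (y + x).
    by move: fg; rewrite (near_shift 0); apply: filterS => y /=; rewrite subr0.
  apply: filterS2 fg0 => y /= fgy.
  by rewrite !fctE /= /shift/= fgy fgx.
have dc : continuous ('d f x) by exact: diff_continuous.
have E := diff_unique dc dg.
by split=> //; apply/diff_locallyP; rewrite E.
Qed.

Lemma Ck_subset V W k (U U' : set V) (f : V -> W) :
  U' `<=` U -> Ck k U f -> Ck k U' f.
Proof.
move=> UU'; elim: k f => [|k IH] f /=; first by move=> H x /UU'/H.
by move=> [H1 H2]; split=> [x /UU'/H1//|v]; exact: IH.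
Qed.

(** Openness of [U] turns equality on [U] into equality near each of its points, so the derivatives
    agree on [U] as well. *)
Lemma Ck_ext V W k (U : set V) (f g : V -> W) :
  open U -> (forall x, U x -> f x = g x) -> Ck k U f -> Ck k U g.
Proof.
move=> oU; elim: k f g => [|k IH] f g fg /=.
  move=> H x Ux; rewrite /prop_for /continuous_at -(fg _ Ux).
  apply: cvg_trans (H x Ux); apply: near_eq_cvg.
  by apply: filterS (open_nbhs_nbhs (conj oU Ux)) => y /fg.
have nfg x : U x -> \forall y \near x, f y = g y.
  by move=> Ux; apply: filterS (open_nbhs_nbhs (conj oU Ux)) => y /fg.
move=> [H1 H2]; split=> [x Ux|v].
  exact: (near_eq_diff (nfg x Ux) (H1 x Ux)).1.
apply: IH (H2 v) => x Ux.
by rewrite (near_eq_diff (nfg x Ux) (H1 x Ux)).2.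
Qed.

Lemma CkW V W k (U : set V) (f : V -> W) : Ck k.+1 U f -> Ck k U f.
Proof.
elim: k f => [|k IH] f [H1 H2].
  by move=> x Ux; apply: differentiable_continuous; exact: H1.
by split=> // v; exact: IH (H2 v).
Qed.

Lemma Ck_cst V W k (U : set V) (a : W) : Ck k U (fun=> a).
Proof.
elim: k a => [|k IH] a /=; first by move=> x _; exact: cvg_cst.
split=> [x _|v]; first exact: differentiable_cst.
rewrite (_ : (fun _ => _) = fun=> 0); first exact: IH.
by apply/funext => x; rewrite diff_cst.
Qed.

Lemma Ck_linear V W k (U : set V) (L : {linear V -> W}) :
  continuous L -> Ck k U L.
Proof.
move=> cL; case: k => [|k] /=; first by move=> x _; exact: cL.
split=> [x _|v]; first exact: linear_differentiable.
rewrite (_ : (fun _ => _) = fun=> L v); first exact: Ck_cst.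
by apply/funext => x; rewrite diff_lin.
Qed.

Lemma CkD V W k (U : set V) (f g : V -> W) : open U ->
  Ck k U f -> Ck k U g -> Ck k U (fun x => f x + g x).
Proof.
move=> oU; elim: k f g => [|k IH] f g /=.
  by move=> Hf Hg x Ux; apply: cvgD; [exact: Hf|exact: Hg].
move=> [f1 f2] [g1 g2]; split=> [x Ux|v].
  by apply: differentiableD; [exact: f1|exact: g1].
apply: (Ck_ext oU _ (IH _ _ (f2 v) (g2 v))) => x Ux.
exact/esym/(congr1 (@^~ v) (diffD (f1 x Ux) (g1 x Ux))).
Qed.

Lemma Ck_sum V W k (U : set V) (I : Type) (s : seq I) (f : I -> V -> W) :
  open U -> (forall i, Ck k U (f i)) -> Ck k U (fun x => \sum_(i <- s) f i x).
Proof.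
move=> oU H; elim: s => [|i s IH].
  by rewrite (_ : (fun _ => _) = fun=> 0); [exact: Ck_cst|
    apply/funext => x; rewrite big_nil].
rewrite (_ : (fun _ => _) = fun x => f i x + \sum_(j <- s) f j x).
  exact: CkD.
by apply/funext => x; rewrite big_cons.
Qed.

Lemma CkM V k (U : set V) (f g : V -> R) : open U ->
  Ck k U f -> Ck k U g -> Ck k U (fun x => f x * g x).
Proof.
move=> oU; elim: k f g => [|k IH] f g Hf Hg /=.
  by move=> x Ux; apply: cvgM; [exact: Hf|exact: Hg].
have [[f1 f2] [g1 g2]] := (Hf, Hg); split=> [x Ux|v].
  by apply: differentiableM; [exact: f1|exact: g1].
(* In the Leibniz rule each derivative is paired with an undifferentiated factor, which [CkW] lowers
   to the same class. *)
have K1 := IH _ _ (CkW Hf) (g2 v).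
have K2 := IH _ _ (CkW Hg) (f2 v).
apply: (Ck_ext oU _ (CkD oU K1 K2)) => x Ux.
rewrite [RHS](congr1 (@^~ v) (diffM (f1 x Ux) (g1 x Ux))).
by rewrite /= [in RHS]/GRing.add/=/GRing.scale/= [g x * _]mulrC.
Qed.

Lemma Ck_linear_comp V W (X : normedModType R) k (U : set V) (f : V -> W)
    (L : {linear W -> X}) : open U -> continuous L ->
  Ck k U f -> Ck k U (fun x => L (f x)).
Proof.
move=> oU cL; elim: k f => [|k IH] f /=.
  by move=> Hf x Ux; apply: cvg_comp (Hf x Ux) (cL _).
have dL y : differentiable L y by exact: linear_differentiable.
move=> [f1 f2]; split=> [x Ux|v].
  by apply: differentiable_comp; [exact: f1|exact: dL].
apply: (Ck_ext oU _ (IH _ (f2 v))) => x Ux.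
by rewrite [RHS](congr1 (@^~ v) (diff_comp (f1 x Ux) (dL _)))/= diff_lin.
Qed.

(* Coordinates reduce the differential of a composition to sums of products of
   scalar functions, on which the induction on k in [Ck_comp] runs. *)
Definition finite_frame W : Prop :=
  exists (I : finType) (e : I -> W) (c : I -> {linear W -> R}),
    (forall i, continuous (c i)) /\ forall w, w = \sum_i c i w *: e i.

Lemma Ck_scalel V W (w : W) k (U : set V) (f : V -> R) : open U ->
  Ck k U f -> Ck k U (fun x => f x *: w).
Proof.
move=> oU Hf.
have sL : linear ( *:%R ^~ w : R -> W).
  by move=> a u v; rewrite scalerDl scalerA.
pose M := GRing.isLinear.Build _ _ _ _ _ sL.
pose L : {linear R -> W} := HB.pack ( *:%R ^~ w : R -> W) M.
exact: (Ck_linear_comp (L := L) oU (scalel_continuous (x := w)) Hf).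
Qed.

Lemma Ck_comp V W k (U : set V) (O : set W) (f : V -> W) (g : W -> R) :
  finite_frame W -> open U -> (forall x, U x -> O (f x)) ->
  Ck k U f -> Ck k O g -> Ck k U (g \o f).
Proof.
move=> [I [e [c [cc ce]]]] oU UO.
elim: k f g UO => [|k IH] f g UO Hf Hg /=.
  by move=> x Ux; apply: cvg_comp (Hf x Ux) (Hg _ (UO _ Ux)).
have [[f1 f2] [g1 g2]] := (Hf, Hg); split=> [x Ux|v].
  by apply: differentiable_comp; [exact: f1|exact/g1/UO].
have K i : Ck k U (fun x => c i ('d f x v) * 'd g (f x) (e i)).
  apply: CkM => //; first exact: (Ck_linear_comp oU (cc i) (f2 v)).
  (* The partial derivative of [g] along [e i] is again scalar, so the induction hypothesis covers
     its composition with [f]. *)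
  exact: IH UO (CkW Hf) (g2 (e i)).
apply: (Ck_ext oU _ (Ck_sum (index_enum I) oU K)) => x Ux.
rewrite [RHS](congr1 (@^~ v) (diff_comp (f1 x Ux) (g1 _ (UO _ Ux))))/= [in RHS](ce ('d f x v)).
by rewrite linear_sum; apply: eq_bigr => i _; rewrite linearZ.
Qed.

Lemma finite_frame_rV n : finite_frame 'rV[R]_n.
Proof.
have lc (i : 'I_n) : linear (fun v : 'rV[R]_n => v ord0 i).
  by move=> a u v; rewrite !mxE.
pose c i : {linear 'rV[R]_n -> R} :=
  HB.pack (fun v : 'rV[R]_n => v ord0 i) (GRing.isLinear.Build _ _ _ _ _ (lc i)).
exists 'I_n, (fun i => delta_mx ord0 i), c; split.
  by move=> i; exact: coord_continuous.
by move=> w; exact: row_sum_delta.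
Qed.

Lemma finite_frame_prod V W :
  finite_frame V -> finite_frame W -> finite_frame (V * W)%type.
Proof.
move=> [I [e [c [cc ce]]]] [J [e' [c' [cc' ce']]]].
pose d (k : I + J) : {linear (V * W)%type -> R} :=
  match k with
  | inl i => c i \o fst
  | inr j => c' j \o snd
  end.
exists (I + J)%type.
exists (fun k => match k with inl i => (e i, 0) | inr j => (0, e' j) end), d.
split=> [[i|j] x|[v w]].
- by apply: cvg_comp; [exact: cvg_fst|exact: cc].
- by apply: cvg_comp; [exact: cvg_snd|exact: cc'].
rewrite big_sumType/= [RHS]surjective_pairing; congr pair.
  rewrite raddfD !raddf_sum/= [X in _ = _ + X]big1 ?addr0; last first.
    by move=> j _; exact: scaler0.
  exact: ce.
rewrite raddfD !raddf_sum/= [X in _ = X + _]big1 ?add0r; last by move=> i _; exact: scaler0.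
exact: ce'.
Qed.

End CkCalculus.

(** * Second derivatives along lines *)

Section SecondDerivatives.
Context {R : realType} {V : normedModType R}.

Lemma is_derive_line (f : V -> R) (a w : V) (s : R) :
  differentiable f (a + s *: w) ->
  is_derive s 1 (fun r : R => f (a + r *: w)) ('d f (a + s *: w) w).
Proof.
move=> df.
have dl : is_diff s (fun r : R => a + r *: w) ( *:%R ^~ w).
  apply: is_diff_eq (is_diffD (is_diff_cst a s) (is_diff_scalel s w)) _.
  exact: add0r.
have dfl : differentiable (f \o (fun r : R => a + r *: w)) s.
  by apply: differentiable_comp.
apply: DeriveDef; first exact/derivable1_diffP.
rewrite deriveE//.
rewrite [LHS](congr1 (@^~ 1) (diff_comp (@ex_diff _ _ _ _ _ _ _ dl) df))/=.
by rewrite (congr1 (@^~ 1) (@diff_val _ _ _ _ _ _ _ dl))/= scale1r.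
Qed.

(* The second difference is symmetric in u and w, which gives the symmetry of
   second derivatives; the estimate applies the mean value theorem first in the
   direction w, then in the direction u. *)
Lemma second_difference_approx (O : set V) (f : V -> R) (z u w : V) (e : R) :
  open O -> O z -> Ck 2 O f -> 0 < e ->
  exists2 d, 0 < d & forall t, 0 < t < d ->
    `|f (z + t *: u + t *: w) - f (z + t *: u) - f (z + t *: w) + f z
      - t ^+ 2 * 'd (fun x => 'd f x w) z u| < e * t ^+ 2.
Proof.
move=> oO Oz [df /(_ w)[ddf /(_ u) ch]] e0.
set D := 'd _ z u.
set h := fun x => 'd (fun x0 => 'd f x0 w) x u.
(* By continuity of the mixed derivative [h] at [z], small parallelograms at [z] stay in [O], and
   [h] is within [e] of [D] on them. *)
have [d d0 Hd] : exists2 d : R, 0 < d & forall r s, 0 <= r < d -> 0 <= s < d ->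
    O (z + r *: u + s *: w) /\ `|h (z + r *: u + s *: w) - D| < e.
  have cl : {for (0, 0), continuous (fun p : R * R => z + p.1 *: u + p.2 *: w)}.
    apply: cvgD; first apply: cvgD; first exact: cvg_cst.
      by apply: cvgZr_tmp; exact: cvg_fst.
    by apply: cvgZr_tmp; exact: cvg_snd.
  have nN : nbhs z [set x | O x /\ `|h x - D| < e].
    apply: filterI; first exact: open_nbhs_nbhs.
    have /cvgrPdist_lt/(_ e e0) := ch z Oz.
    by apply: filterS => x; rewrite distrC.
  have := cl [set x | O x /\ `|h x - D| < e].
  rewrite /= !scale0r !addr0 => /(_ nN) /nbhs_ballP[d /= d0 Hd].
  exists d => // r s /andP[r0 rd] /andP[s0 sd].
  apply: (Hd (r, s)); split; rewrite /ball/= sub0r normrN ger0_norm//.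
exists d => // t /andP[t0 td].
have t0' : 0 <= t by exact: ltW.
have bnd s : s \in `[0, t]%R -> 0 <= s < d.
  by rewrite in_itv/= => /andP[-> /le_lt_trans ->].
have bndo s : s \in `]0, t[%R -> 0 <= s < d.
  by move=> st; apply: bnd; exact: subset_itv_oo_cc.
have t0d : 0 <= t < d by rewrite t0'.
have z0d : (0:R) <= 0 < d by rewrite lexx.
(* The vanishing term [0 *: u] lets [Hd] treat both ends of the increment alike. *)
pose phi (s : R) := f (z + t *: u + s *: w) - f (z + 0 *: u + s *: w).
have dphi s : 0 <= s < d ->
    is_derive s 1 phi ('d f (z + t *: u + s *: w) w - 'd f (z + 0 *: u + s *: w) w).
  move=> sd; apply: is_deriveB; apply: is_derive_line; apply: df.
    exact: (Hd _ _ t0d sd).1.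
  exact: (Hd _ _ z0d sd).1.
have [xi xit] : exists2 c, c \in `]0, t[%R & phi t - phi 0 =
    ('d f (z + t *: u + c *: w) w - 'd f (z + 0 *: u + c *: w) w) * (t - 0).
  apply: (MVT t0 (fun s st => dphi s (bndo s st))).
  apply: derivable_within_continuous => s /bnd sd.
  exact: (@ex_derive _ _ _ _ _ _ _ (dphi s sd)).
rewrite subr0 => phit.
have xid := bndo _ xit.
pose psi (r : R) := 'd f (z + xi *: w + r *: u) w.
have dpsi r : 0 <= r < d -> is_derive r 1 psi (h (z + xi *: w + r *: u)).
  move=> rd; apply: (is_derive_line (f := fun x => 'd f x w)).
  by apply: ddf; rewrite addrAC; apply: (Hd _ _ rd xid).1.
have [eta etat] : exists2 c, c \in `]0, t[%R & psi t - psi 0 =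
    h (z + xi *: w + c *: u) * (t - 0).
  apply: (MVT t0 (fun s st => dpsi s (bndo s st))).
  apply: derivable_within_continuous => s /bnd sd.
  exact: (@ex_derive _ _ _ _ _ _ _ (dpsi s sd)).
rewrite subr0 => psit.
have -> : f (z + t *: u + t *: w) - f (z + t *: u) - f (z + t *: w) + f z =
    t ^+ 2 * h (z + eta *: u + xi *: w).
  transitivity (phi t - phi 0).
    by rewrite /phi !scale0r !addr0; ring.
  rewrite phit expr2 mulrC -mulrA; congr (_ * _).
  by rewrite mulrC [z + eta *: u + _]addrAC -psit /psi !scale0r !addr0
    [z + xi *: w + _]addrAC.
rewrite -mulrBr normrM ger0_norm ?exprn_ge0// mulrC ltr_pM2r ?exprn_gt0//.
exact: (Hd _ _ (bndo _ etat) xid).2.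
Qed.

(** For a common small [t], both mixed derivatives times [t ^+ 2] lie within [e / 2 * t ^+ 2] of the
    same second difference, so they differ by at most [e], for every [e > 0]. *)
Lemma diff2_sym (O : set V) (f : V -> R) (z u w : V) :
  open O -> O z -> Ck 2 O f ->
  'd (fun x => 'd f x w) z u = 'd (fun x => 'd f x u) z w.
Proof.
move=> oO Oz Cf; set A := LHS; set B := RHS.
apply/eqP; rewrite -subr_eq0 -normr_le0; apply/ler_addgt0Pr => e e0.
rewrite add0r; have e20 : 0 < e / 2 by rewrite divr_gt0.
have [d1 d10 H1] := second_difference_approx u w oO Oz Cf e20.
have [d2 d20 H2] := second_difference_approx w u oO Oz Cf e20.
pose t := Num.min d1 d2 / 2.
have m0 : 0 < Num.min d1 d2 by rewrite lt_min d10.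
have t0 : 0 < t by rewrite divr_gt0.
have tm : t < Num.min d1 d2 by rewrite ltr_pdivrMr// mulr_natr mulr2n ltrDl.
have [td1 td2] : t < d1 /\ t < d2 by apply/andP; rewrite -lt_min.
have {}H1 := H1 t; have {}H2 := H2 t.
rewrite t0 td1 in H1; rewrite t0 td2 in H2.
have {}H1 := H1 isT; have {}H2 := H2 isT.
rewrite -/A in H1; rewrite -/B in H2.
rewrite [z + t *: w + t *: u]addrAC in H2.
set X := f (z + t *: u + t *: w) - f (z + t *: u) - f (z + t *: w) + f z in H1.
have XE : f (z + t *: u + t *: w) - f (z + t *: w) - f (z + t *: u) + f z = X.
  by rewrite /X; ring.
rewrite XE in H2.
have t20 : 0 < t ^+ 2 by rewrite exprn_gt0.
rewrite -(ler_pM2l t20) -(ger0_norm (ltW t20)) -normrM mulrBr.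
have -> : t ^+ 2 * A - t ^+ 2 * B = (X - t ^+ 2 * B) - (X - t ^+ 2 * A).
  by ring.
rewrite (le_trans (ler_normB _ _))// (ger0_norm (ltW t20)).
rewrite (le_trans (lerD (ltW H2) (ltW H1)))// -mulrDl -splitr mulrC//.
Qed.

End SecondDerivatives.

Section LineDerivatives.
Context {R : realType} {V : normedModType R}.
Variables (O : set V) (f : V -> R) (z u w : V).
Hypotheses (oO : open O) (Oz : O z) (Cf : Ck 2 O f).

Let near_line : \forall r \near (0 : R), O (z + r *: u).
Proof.
have cl : {for 0, continuous (fun r : R => z + r *: u)}.
  by apply: cvgD; [exact: cvg_cst|apply: cvgZr_tmp; exact: cvg_id].
by apply: cl; rewrite scale0r addr0; exact: open_nbhs_nbhs.
Qed.

Lemma is_derive_line0 r : O (z + r *: u) ->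
  is_derive (0 : R) 1 (fun s : R => f (z + r *: u + s *: w)) ('d f (z + r *: u) w).
Proof.
move=> Or; rewrite -[X in 'd f X w]addr0 -(scale0r w).
by apply: is_derive_line; rewrite scale0r addr0; exact: Cf.1.
Qed.

(** Links the iterated derivative in [fundamental_tensor] to iterated differentials: for [r] near 0
    the point [z + r *: u] stays in [O], where the inner derivative is a value of the
    differential. *)
Lemma is_derive_derive_line : is_derive (0 : R) 1
  (fun r : R => derive1 (fun s : R => f (z + r *: u + s *: w)) 0)
  ('d (fun x => 'd f x w) z u).
Proof.
have := @is_derive_line _ _ (fun x => 'd f x w) z u 0.
rewrite scale0r addr0 => /(_ ((Cf.2 w).1 _ Oz)).
apply: near_eq_is_derive; apply: filterS near_line => r /is_derive_line0 H.
by rewrite derive1E (@derive_val _ _ _ _ _ _ _ H).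
Qed.

End LineDerivatives.

(** * One-sided derivatives of real functions *)

Section OneSidedDerivatives.
Context {R : realType}.
Implicit Types f p : R -> R.

(** If [f] has no derivative at [x], neither has its negative, and both sides are the default value
    0; the sign thus comes out of a derivative in all cases. *)
Lemma derive1_subl (a : R) f x : derive1 (fun s => a - f s) x = - derive1 f x.
Proof.
have E : derive1 (fun s => a - f s) x = derive1 (fun s => - f s) x.
  rewrite /derive1 (_ : (fun h => h^-1 *: (a - f (h + x) - (a - f x))) =
      fun h => h^-1 *: (- f (h + x) - - f x))//.
  by apply/funext => h; congr (_ *: _); ring.
rewrite E !derive1E.
have [df|ndf] := pselect (derivable f x 1); first exact: deriveN.
have ndNf : ~ derivable (fun s => - f s) x 1.
  by move=> /derivableN; rewrite (_ : - _ = f)//; apply/funext => s; exact: opprK.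
by rewrite /derive (dvgP ndf) (dvgP ndNf) oppr0.
Qed.

(** A derivative that exists is the right-hand limit of the difference quotient, which only involves
    nonnegative arguments. *)
Lemma derive1_eq_right f p : derivable f 0 1 -> derivable p 0 1 ->
  (forall x : R, 0 <= x -> f x = p x) -> derive1 f 0 = derive1 p 0.
Proof.
move=> df dp fp; rewrite !derive1E /derive.
rewrite (@cvg_at_rightE _ _ _ _ df) (@cvg_at_rightE _ _ _ _ dp).
have near_fp : {near 0^'+, (fun h : R => h^-1 *: ((f \o shift 0) (h *: 1) - f 0)) =1
    (fun h : R => h^-1 *: ((p \o shift 0) (h *: 1) - p 0))}.
  near=> h; have h0 : 0 <= h by apply: ltW; near: h; exact: nbhs_right_gt.
  by rewrite /= !addr0 !fp// [h%:A]mulr1.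
by congr lim; rewrite eqEsubset; split; apply: near_eq_cvg => //;
  apply: filterS near_fp => h ->.
Unshelve. all: by end_near. Qed.

Lemma is_derive_quadratic (a c r x : R) :
  is_derive x 1 (fun s => c - a * (r + s) ^+ 2) (- (2 * a * (r + x))).
Proof.
have H := is_deriveD (is_derive_cst r x 1) (is_derive_id x 1).
apply: is_derive_eq
  (is_deriveB (is_derive_cst c x 1) (is_deriveZ a (is_deriveM H H))) _.
by rewrite !fctE /GRing.scale/=; ring.
Qed.

(** Meant for points of [span_field T]. For [r > 0] the function is quadratic near [r]; at [r = 0]
    derivability reduces the derivative to its right-hand value. The same reduction then handles the
    outer derivative. *)
Lemma second_derive_right f (a c : R) :
  (forall x : R, 0 <= x -> f x = c - a * x ^+ 2) -> derivable f 0 1 ->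
  derivable (fun r => derive1 (fun s => f (r + s)) 0) 0 1 ->
  derive1 (fun r => derive1 (fun s => f (r + s)) 0) 0 = - (2 * a).
Proof.
move=> fE df ddf.
have lE r : 0 <= r -> derive1 (fun s => f (r + s)) 0 = - (2 * a * r).
  rewrite le_eqVlt => /orP[/eqP <-|r0].
    rewrite (_ : (fun s => f (0 + s)) = f); last first.
      by apply/funext => s; rewrite add0r.
    have Q := is_derive_quadratic a c 0 0.
    rewrite (derive1_eq_right df (@ex_derive _ _ _ _ _ _ _ Q)).
      by rewrite derive1E (@derive_val _ _ _ _ _ _ _ Q) addr0.
    by move=> x x0; rewrite fE// add0r.
  rewrite -[X in _ * X](addr0 r) -(@derive_val _ _ _ _ _ _ _ (is_derive_quadratic a c r 0))
    derive1E.
  apply: near_eq_derive.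
  have : \forall s \near (0 : R), `|s| < r by exact: nbhs0_lt.
  apply: filterS => s sr; rewrite fE//.
  by move: sr; rewrite ltr_norml => /andP[rs _]; rewrite -lerBlDl sub0r ltW.
have dl : is_derive (0 : R) 1 (fun r : R => - (2 * a * r)) (- (2 * a)).
  apply: is_derive_eq
    (is_deriveN (is_deriveZ (2 * a) (is_derive_id (0 : R) 1))) _.
  by rewrite /GRing.scale/= mulr1.
rewrite (derive1_eq_right ddf (@ex_derive _ _ _ _ _ _ _ dl) lE).
by rewrite derive1E (@derive_val _ _ _ _ _ _ _ dl).
Qed.

End OneSidedDerivatives.

(** * Lorentzian bases *)

Section LorentzBasis.
Context {R : realType} {V : vectType R}.
Variable g : V -> V -> R.
Hypothesis g_sb : symmetric_bilinear g.

Lemma sb_add u u' w : g (u + u') w = g u w + g u' w.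
Proof. by have := g_sb.2 1 u u' w; rewrite scale1r mul1r. Qed.

Lemma sb0 w : g 0 w = 0.
Proof. by apply: (addrI (g 0 w)); rewrite -sb_add !addr0. Qed.

Lemma sb_scale a u w : g (a *: u) w = a * g u w.
Proof. by have := g_sb.2 a u 0 w; rewrite !addr0 sb0 addr0. Qed.

Lemma sb_sum (I : Type) (s : seq I) (F : I -> V) w :
  g (\sum_(i <- s) F i) w = \sum_(i <- s) g (F i) w.
Proof.
elim: s => [|i s IH]; first by rewrite !big_nil sb0.
by rewrite !big_cons sb_add IH.
Qed.

(** The Gram matrix diag(1, -1, ..., -1), indexed by [nat] so as to serve for families of every
    length. *)
Let eta (i j : nat) : R := if i == j then (if i == 0%N then 1 else -1) else 0.

Variables (om : {scalar V}) (T : V).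
Hypothesis omT : om T = 1.
Hypothesis gTT : g T T = 1.
Hypothesis gTker : forall w, om w = 0 -> g T w = 0.
Hypothesis gker : forall w, om w = 0 -> w != 0 -> g w w < 0.

(** Split [u] into [om u *: T] and a kernel vector, which is orthogonal to [T]. The orthogonal
    complement of [T] is thus the kernel of [om]. *)
Lemma gTE u : g T u = om u.
Proof.
rewrite -[u in LHS](subrK (om u *: T)) g_sb.1 sb_add sb_scale gTT mulr1 g_sb.1.
by rewrite gTker ?add0r// linearB linearZ/= omT mulr1 subrr.
Qed.

(** A vector orthogonal to everything is orthogonal to [T], hence lies in the kernel of [om], where
    [g] is negative definite. *)
Lemma lorentz_nondegenerate : nondegenerate_form g.
Proof.
move=> u Hu; apply/eqP/contraT => u0.
have omu : om u = 0 by rewrite -gTE g_sb.1.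
by have := gker omu u0; rewrite Hu ltxx.
Qed.

(** Gram-Schmidt started from [T]: each later vector is orthogonal to [T], so it lies in the kernel
    of [om] and has negative square. *)
Lemma lorentz_family k : (0 < k <= \dim {:V})%N ->
  exists e : seq V, [/\ size e = k, e`_0 = T &
    forall i j, (i < k)%N -> (j < k)%N -> g e`_i e`_j = eta i j].
Proof.
elim: k => // -[_ _|k IH kn].
  by exists [:: T]; split=> // -[|//] [|//] _ _; rewrite gTT.
have [|e [es e0 eo]] := IH; first by rewrite /= ltnW//; case/andP: kn.
(* The [k.+1] vectors found so far cannot span a space of larger dimension. *)
have [u ue] : exists u, u \notin <<e>>%VS.
  apply: contrapT => /forallNP H.
  have /dimvS : (fullv <= <<e>>)%VS.
    by apply/subvP => u _; apply/negPn/negP/H.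
  move=> /leq_trans/(_ (dim_span e)); rewrite es leqNgt.
  by case/andP: kn => _ ->.
(* The square of each earlier vector is 1 or -1, its own inverse, so the factor [eta i i] replaces
   the division in the usual projection. *)
pose w := u - \sum_(i < k.+1) (eta i i * g u e`_i) *: e`_i.
have w0 : w != 0.
  apply: contra ue; rewrite subr_eq0 => /eqP ->.
  by apply: rpred_sum => i _; apply/rpredZ/memv_span/mem_nth; rewrite es.
have wo j : (j < k.+1)%N -> g w e`_j = 0.
  move=> jk; rewrite /w sb_add -scaleN1r sb_scale sb_sum.
  rewrite (bigD1 (Ordinal jk))//= big1 => [|i ij].
    rewrite sb_scale eo// /eta eqxx; case: ifP => _; ring.
  rewrite sb_scale eo// [X in _ * X](_ : _ = 0) ?mulr0// /eta ifF//; apply/negbTE.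
  by apply: contra ij => /eqP ij; apply/eqP/val_inj.
have omw : om w = 0 by rewrite -gTE g_sb.1 -e0 wo.
have gw := gker omw w0.
pose s := Num.sqrt (- g w w).
have s2 : s ^+ 2 = - g w w by rewrite sqr_sqrtr// oppr_ge0 ltW.
have s0 : s != 0 by rewrite -sqrf_eq0 s2 oppr_eq0 lt_eqF.
pose v := s^-1 *: w.
have vo j : (j < k.+1)%N -> g v e`_j = 0 by move=> jk; rewrite sb_scale wo// mulr0.
have vv : g v v = -1.
  rewrite sb_scale g_sb.1 sb_scale -[g w w]opprK -s2.
  by field; exact: s0.
exists (rcons e v); split; first by rewrite size_rcons es.
  by rewrite nth_rcons es.
move=> i j; rewrite !ltnS !nth_rcons es => ik jk.
have [ik'|ki] := ltnP i k.+1; have [jk'|kj] := ltnP j k.+1.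
- exact: eo.
- have -> : j = k.+1 by apply/eqP; rewrite eqn_leq jk.
  by rewrite eqxx g_sb.1 vo// /eta ltn_eqF.
- have -> : i = k.+1 by apply/eqP; rewrite eqn_leq ik.
  by rewrite eqxx vo// /eta gtn_eqF.
have -> : i = k.+1 by apply/eqP; rewrite eqn_leq ik.
have -> : j = k.+1 by apply/eqP; rewrite eqn_leq jk.
by rewrite eqxx vv /eta eqxx.
Qed.

Lemma lorentz_signature n : \dim {:V} = n -> lorentzian_signature n g.
Proof.
move=> dn.
(* [T] is nonzero because [om T = 1]; the family starts with this vector. *)
have n0 : (0 < n)%N.
  rewrite -dn lt0n dimv_eq0; apply/eqP => V0.
  have : T \in fullv by exact: memvf.
  rewrite V0 memv0 => /eqP T0; move: omT; rewrite T0 linear0 => /eqP.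
  by rewrite eq_sym oner_eq0.
have [|e [es e0 eo]] := @lorentz_family n; first by rewrite dn n0 leqnn.
have sz : size e == n by rewrite es.
pose t := Tuple sz.
have eot (i j : 'I_n) : g (tnth t i) (tnth t j) = eta i j.
  by rewrite !(tnth_nth 0)/= eo.
exists t; last by move=> i j; rewrite eot.
rewrite basisEfree subvf dn es leqnn !andbT.
(* Pairing a vanishing combination with the [i]-th vector leaves [c i] times 1 or -1, so the family
   is free. *)
apply/freeP => c c0 i.
have : g (\sum_(j < n) c j *: t`_j) t`_i = 0 by rewrite c0 sb0.
rewrite sb_sum (bigD1 i)//= big1 => [|j ji]; last first.
  rewrite sb_scale eo// [X in _ * X](_ : _ = 0) ?mulr0// /eta ifF//; apply/negbTE.
  by apply: contra ji => /eqP ij; apply/eqP/val_inj.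
rewrite addr0 sb_scale eo// /eta eqxx => /eqP; rewrite mulf_eq0 => /orP[/eqP//|].
by case: ifP => _; rewrite ?oppr_eq0 oner_eq0.
Qed.

End LorentzBasis.

(** * Charts of the tangent bundle *)

Lemma open_setI_preimage (X Y : topologicalType) (U : set X) (O : set Y)
    (f : X -> Y) :
  open U -> (forall x, U x -> {for x, continuous f}) -> open O ->
  open (U `&` f @^-1` O).
Proof.
move=> oU cf oO; rewrite openE => x [Ux Ofx]; apply: filterI.
  exact: open_nbhs_nbhs.
by apply: (cf x Ux); exact: open_nbhs_nbhs.
Qed.

Section Charts.
Context {R : realType} {n : nat} {M : smoothManifold R n}.
Implicit Types (i j : chart_index M) (p : M).

Lemma chart_codom i p : dom i p -> codom_of i (chart i p).
Proof. by exists p. Qed.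

Lemma codom_dom i x : codom_of i x -> dom i (chart_inv i x).
Proof. by move=> [p ip <-]; rewrite chartK. Qed.

Lemma dom_chart_at p : dom (chart_at p) p.
Proof. exact: projT2 (cid (dom_cover p)). Qed.

Lemma open_overlap i j : open (chart i @` (dom i `&` dom j)).
Proof.
have -> : chart i @` (dom i `&` dom j) = codom_of i `&` chart_inv i @^-1` dom j.
  apply/seteqP; split=> [_ [p [ip jp] <-]|_ [[p ip <-]]].
    by split; [exists p|rewrite /= chartK].
  by rewrite /= chartK// => jp; exists p.
apply: open_setI_preimage; [exact: codom_open| |exact: dom_open].
move=> x ix; have := chart_inv_continuous (i := i).
rewrite continuous_open_subspace; last exact: codom_open.
by apply; rewrite inE.
Qed.

Lemma transition_differentiable i j p : dom i p -> dom j p ->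
  differentiable (chart j \o chart_inv i) (chart i p).
Proof. by move=> ip jp; apply: (transition_smooth i j 1).1; exists p. Qed.

(** The two transition maps are mutually inverse on the overlap, an open neighbourhood of
    [chart j p], so by the chain rule their differentials compose to that of the identity. *)
Lemma transition_diffK i j p (y : 'rV[R]_n) : dom i p -> dom j p ->
  'd (chart j \o chart_inv i) (chart i p)
    ('d (chart i \o chart_inv j) (chart j p) y) = y.
Proof.
move=> ip jp.
have E : (chart i \o chart_inv j) (chart j p) = chart i p by rewrite /= chartK.
have d1 := transition_differentiable jp ip.
have d2 : differentiable (chart j \o chart_inv i)
    ((chart i \o chart_inv j) (chart j p)).
  by rewrite E; exact: transition_differentiable.
rewrite -[X in 'd _ X ('d _ _ _)]E.
rewrite -[LHS](congr1 (@^~ y) (diff_comp d1 d2)).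
have nid : \forall x \near chart j p,
    id x = ((chart j \o chart_inv i) \o (chart i \o chart_inv j)) x.
  have : nbhs (chart j p) (chart j @` (dom j `&` dom i)).
    by apply: open_nbhs_nbhs; split; [exact: open_overlap|exists p].
  by apply: filterS => _ [q [jq iq] <-]; rewrite /= chartK// chartK.
have did : differentiable (@id 'rV[R]_n) (chart j p) by [].
rewrite (near_eq_diff nid did).2.
by rewrite (congr1 (@^~ y) (@diff_val _ _ _ _ _ _ _ (is_diff_id (chart j p)))).
Qed.

Lemma dchartK i p : dom i p -> cancel (@dchart _ _ _ i p) (@dchart_inv _ _ _ i p).
Proof. by move=> ip v; apply: transition_diffK => //; exact: dom_chart_at. Qed.

Lemma dchart_invK i p :
  dom i p -> cancel (@dchart_inv _ _ _ i p) (@dchart _ _ _ i p).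
Proof. by move=> ip v; apply: transition_diffK => //; exact: dom_chart_at. Qed.

Lemma dchart_linear i p (a : R) (u v : 'rV[R]_n) :
  @dchart _ _ _ i p (a *: u + v) = a *: @dchart _ _ _ i p u + @dchart _ _ _ i p v.
Proof. exact: linearP. Qed.

Lemma dchart_inv_linear i p (a : R) (u v : 'rV[R]_n) :
  @dchart_inv _ _ _ i p (a *: u + v) =
  a *: (@dchart_inv _ _ _ i p u : 'rV[R]_n) + @dchart_inv _ _ _ i p v.
Proof. exact: linearP. Qed.

Lemma Tchart_invE i p (y : 'rV[R]_n) :
  dom i p -> Tchart_inv i (chart i p, y) = tvec p (dchart_inv i p y).
Proof. by move=> ip; rewrite /Tchart_inv/= chartK. Qed.

Lemma open_Tcodom i : open (Tcodom i).
Proof.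
have -> : Tcodom i = setT `&` fst @^-1` codom_of i by rewrite setTI.
apply: open_setI_preimage; [exact: openT| |exact: codom_open].
by move=> z _; exact: cvg_fst.
Qed.

End Charts.

(** * The cone function *)

Section ConeFunction.
Context {R : realType} {n : nat} {M : smoothManifold R n}.
Variables (Om : forall p : M, {scalar tangent p}) (T : forall p : M, tangent p).
Variable F : TM M -> R.
Arguments Om : clear implicits.
Hypothesis hT : cone_triple Om T F.
Implicit Types (i : chart_index M) (p : M).

(** The projection onto the kernel along [T]. *)
Definition ker_part p (v : tangent p) : tangent p := v - Om p v *: T p.

Lemma ker_part_ker p (v : tangent p) : Om p (ker_part v) = 0.
Proof. by rewrite linearB linearZ/= (triple_normalized hT) mulr1 subrr. Qed.

(** [Om] as a function on the tangent bundle, read in the chart [i]. *)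
Definition form_coord i (z : 'rV[R]_n * 'rV[R]_n) : R :=
  Om (chart_inv i z.1) (dchart_inv i (chart_inv i z.1) z.2).

(** [ker_part] read in the chart [i]. *)
Definition ker_coord i (z : 'rV[R]_n * 'rV[R]_n) : 'rV[R]_n * 'rV[R]_n :=
  (z.1, z.2 - form_coord i z *: dchart i (T (chart_inv i z.1))).

Lemma Tchart_inv_ker_coord i z : Tcodom i z -> Tchart_inv i (ker_coord i z) =
  tvec (chart_inv i z.1) (ker_part (dchart_inv i (chart_inv i z.1) z.2)).
Proof.
move=> iz; rewrite /Tchart_inv/= /ker_coord/=; congr tvec.
rewrite addrC -scaleNr dchart_inv_linear dchartK; last exact: codom_dom.
by rewrite scaleNr addrC.
Qed.

(** [smooth_one_form] speaks of one fixed vector at a time; expanding the fibre coordinate in a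
    frame and using linearity of [Om] gives joint smoothness. *)
Lemma form_coord_smooth i k : Ck k (Tcodom i) (form_coord i).
Proof.
have oT := @open_Tcodom _ _ _ i.
have [I [e [c [cc ce]]]] := finite_frame_rV (R := R) n.
have cs : continuous (snd : 'rV[R]_n * 'rV[R]_n -> 'rV[R]_n).
  by move=> z; exact: cvg_snd.
have cf : continuous (fst : 'rV[R]_n * 'rV[R]_n -> 'rV[R]_n).
  by move=> z; exact: cvg_fst.
have K j : Ck k (Tcodom i) (fun z => c j z.2 * form_coord i (z.1, e j)).
  apply: CkM => //.
    exact: (Ck_linear_comp oT (cc j) (Ck_linear k (Tcodom i) (L := snd) cs)).
  apply: (Ck_comp (O := codom_of i) (finite_frame_rV (R := R) n) oT _
    (Ck_linear k (Tcodom i) (L := fst) cf)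
    (triple_form_smooth hT i (e j) k)) => //.
apply: (Ck_ext oT _ (Ck_sum (index_enum I) oT K)) => z _.
rewrite /form_coord/= [in RHS](ce z.2) /dchart_inv !linear_sum/=.
by apply: eq_bigr => j _; rewrite !linearZ.
Qed.

(** [Ck_comp] handles scalar functions, so the vector field is expanded in a frame: the map is the
    identity plus scalar functions times the constant vectors [(0, - e j)]. *)
Lemma ker_coord_smooth i k : Ck k (Tcodom i) (ker_coord i).
Proof.
have oT := @open_Tcodom _ _ _ i.
have [I [e [c [cc ce]]]] := finite_frame_rV (R := R) n.
have cf : continuous (fst : 'rV[R]_n * 'rV[R]_n -> 'rV[R]_n).
  by move=> z; exact: cvg_fst.
pose tau x := dchart i (T (chart_inv i x)).
have K j : Ck k (Tcodom i)
    (fun z => (form_coord i z * c j (tau z.1)) *: ((0, - e j) : 'rV[R]_n * 'rV[R]_n)).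
  apply: Ck_scalel => //; apply: CkM => //; first exact: form_coord_smooth.
  have Kc : Ck k (codom_of i) (fun x => c j (tau x)).
    have oC : open (codom_of i) by exact: codom_open.
    exact: (Ck_linear_comp oC (cc j) (triple_field_smooth hT i k)).
  have Kf := Ck_linear k (Tcodom i) (L := fst) cf.
  exact: (Ck_comp (finite_frame_rV n) oT _ Kf Kc).
have Kid : Ck k (Tcodom i) (@idfun ('rV[R]_n * 'rV[R]_n)%type).
  by apply: (Ck_linear k (Tcodom i) (L := idfun)) => z; exact: cvg_id.
apply: (Ck_ext oT _ (CkD oT Kid (Ck_sum (index_enum I) oT K))) => z _.
rewrite /ker_coord -/(tau z.1) [in RHS](ce (tau z.1)) [LHS]surjective_pairing.
congr pair; rewrite !raddfD !raddf_sum/=.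
  by rewrite big1 ?addr0// => j _; exact: scaler0.
congr (_ + _); apply: eq_bigr => j _.
by rewrite scalerN scalerA.
Qed.

Variable G : TM M -> R.
Hypothesis hG : cone_function Om T F G.

(** Writing [v] as [Om p v *: T p + ker_part v] puts every vector in the form covered by
    [cone_function]; this also yields uniqueness of [G]. *)
Lemma cone_functionE p (v : tangent p) :
  G (tvec p v) = Om p v ^+ 2 - F (tvec p (ker_part v)) ^+ 2.
Proof.
by rewrite -(hG _ (ker_part_ker v)) /ker_part addrC subrK.
Qed.

Lemma cone_function_coord i z : Tcodom i z ->
  G (Tchart_inv i z) =
  form_coord i z ^+ 2 - F (Tchart_inv i (ker_coord i z)) ^+ 2.
Proof. by move=> iz; rewrite Tchart_inv_ker_coord// -cone_functionE. Qed.

Lemma Tcodom_ker_coord i z : Tcodom i z ->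
  Tcodom i (ker_coord i z) /\ ker_form Om (Tchart_inv i (ker_coord i z)).
Proof. by move=> iz; split=> //; rewrite Tchart_inv_ker_coord//; exact: ker_part_ker. Qed.

Lemma cone_function_continuous : TM_continuous_on setT G.
Proof.
move=> i; rewrite preimage_setT setIT.
have oT := @open_Tcodom _ _ _ i.
rewrite continuous_open_subspace// => z; rewrite inE => iz.
have Fc := finsler_continuous (triple_finsler hT) (i := i).
set A := _ `&` _ in Fc.
have AK z' : Tcodom i z' -> A (ker_coord i z') by exact: Tcodom_ker_coord.
have near_Tcodom : \forall z' \near z, Tcodom i z' by exact: open_nbhs_nbhs.
(* [F] is continuous only within the kernel; as [ker_coord] takes its values there, the restricted
   limit pulls back to a full one. *)
have Fz : (fun z' => F (Tchart_inv i (ker_coord i z'))) @ z -->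
    F (Tchart_inv i (ker_coord i z)).
  have /subspace_continuousP/(_ _ (AK _ iz)) := Fc.
  apply: cvg_trans => B /= HB.
  have kc : {for z, continuous (ker_coord i)} by exact: (ker_coord_smooth i 0).
  apply: filterS2 near_Tcodom (kc _ HB) => z' iz'.
  by apply; exact: AK.
have oz : form_coord i @ z --> form_coord i z by exact: (form_coord_smooth i 0).
have : (fun z' => form_coord i z' ^+ 2 - F (Tchart_inv i (ker_coord i z')) ^+ 2) @ z
    --> form_coord i z ^+ 2 - F (Tchart_inv i (ker_coord i z)) ^+ 2.
  by rewrite !expr2; apply: cvgB; apply: cvgM.
rewrite /prop_for /continuous_at /= cone_function_coord//.
apply: cvg_trans; apply: near_eq_cvg; apply: filterS near_Tcodom => z' iz'.
by rewrite /= cone_function_coord.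
Qed.

Lemma cone_function_homogeneous : two_homogeneous G.
Proof.
move=> p v l l0; rewrite !cone_functionE.
have OmZ : Om p (l *: v) = l * Om p v by exact: linearZ.
have -> : @ker_part p (l *: v) = l *: @ker_part p v.
  by rewrite /ker_part OmZ scalerBr scalerA.
rewrite (finsler_homogeneous (triple_finsler hT) (ker_part_ker v) l0).
by rewrite OmZ; ring.
Qed.

(** Off [span_field T] the kernel part is nonzero, so near it [F] agrees along the slit kernel with
    a smooth [g], and [g \o ker_coord i] replaces the [F] term. *)
Lemma cone_function_smooth_at (v : TM M) :
  ~ span_field T v -> TM_smooth_at v G.
Proof.
case: v => p v vT i ip; rewrite /Tdom/= in ip.
have oT := @open_Tcodom _ _ _ i.
set z0 := Tchart i _.
have z0E : z0 = (chart i p, dchart i v) by [].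
have iz0 : Tcodom i z0 by exact: chart_codom.
have Kz0 : ker_coord i z0 = Tchart i (tvec p (ker_part v)).
  rewrite z0E /ker_coord/form_coord/= chartK// dchartK//; congr pair.
  by rewrite /ker_part addrC -scaleNr -dchart_linear scaleNr addrC.
have kv0 : ker_part v != 0 :> 'rV[R]_n.
  apply/eqP => k0; apply: vT; exists p, (Om p v); congr tvec.
  by apply/eqP; rewrite -subr_eq0; exact/eqP.
have [//|O [g [[oO Oz] gs gF]]] := finsler_smooth (triple_finsler hT)
  (v := tvec p (ker_part v)) (conj (ker_part_ker v) kv0) (i := i).
rewrite -Kz0 in Oz.
(* Excluding zero fibre coordinates keeps the projected vectors in the slit kernel, the only place
   where [g] is known to equal [F]. *)
pose O2 : set ('rV[R]_n * 'rV[R]_n) := O `&` snd @^-1` [set~ 0].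
have oN : open [set~ (0 : 'rV[R]_n)].
  apply: closed_openC; apply: accessible_closed_set1.
  exact: hausdorff_accessible (@norm_hausdorff _ _).
have oO2 : open O2.
  apply: (open_setI_preimage (f := snd) oO _ oN) => z _; exact: cvg_snd.
pose U := Tcodom i `&` ker_coord i @^-1` O2.
have oU : open U.
  by apply: open_setI_preimage => //; exact: (ker_coord_smooth i 0).
have O2z0 : O2 (ker_coord i z0).
  split=> //; rewrite Kz0 => /(congr1 (@dchart_inv _ _ _ i p)).
  by rewrite /= dchartK// /dchart_inv linear0; exact/eqP.
exists U => //.
move=> k.
have KK : Ck k U (g \o ker_coord i).
  apply: (Ck_comp (O := O) _ oU _ (Ck_subset _ (ker_coord_smooth i k)) (gs k)).
  - exact: finite_frame_prod (finite_frame_rV n) (finite_frame_rV n).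
  - by move=> z [_ []].
  - by move=> z [].
have Kf : Ck k U (form_coord i).
  by apply: Ck_subset (form_coord_smooth i k) => z [].
have KN : Ck k U (fun z => -1 * ((g \o ker_coord i) z * (g \o ker_coord i) z)).
  by apply: CkM => //; [exact: Ck_cst|exact: CkM].
apply: (Ck_ext oU _ (CkD oU (CkM oU Kf Kf) KN)) => z [iz [Oz2 z2]].
rewrite /= cone_function_coord// gF//; first by ring.
split; first exact: (Tcodom_ker_coord iz).2.
apply/eqP => /(congr1 (@dchart _ _ _ i _)).
rewrite /= dchart_invK; last exact: codom_dom.
by rewrite /dchart linear0; exact: z2.
Qed.

End ConeFunction.

(** * The fundamental tensor *)

Section FundamentalTensor.
Context {R : realType} {n : nat} {M : smoothManifold R n}.
Variables (L : TM M -> R) (p : M) (v : tangent p).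
Hypothesis hL : TM_smooth_at (tvec p v) L.

Let i := chart_at p.
(** Tangent vectors become vertical directions, because the derivatives are taken inside one
    fibre. *)
Let lift (u : tangent p) : 'rV[R]_n * 'rV[R]_n := (0, dchart i u).
Let z := Tchart i (tvec p v).
Let Lc := L \o Tchart_inv i.

Let lift_linear a u w : lift (a *: u + w) = a *: lift u + lift w.
Proof. by rewrite /lift dchart_linear; congr pair; rewrite /= scaler0 addr0. Qed.

Let L_lineE (u w : tangent p) r s :
  L (tvec p (v + r *: u + s *: w)) = Lc (z + r *: lift u + s *: lift w).
Proof.
have ip := dom_chart_at p.
have -> : z + r *: lift u + s *: lift w = Tchart i (tvec p (v + r *: u + s *: w)).
  congr pair; first by rewrite /= !scaler0 !addr0.
  by rewrite /= /dchart !linearD !linearZ.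
by rewrite /Lc /= Tchart_invE// dchartK.
Qed.

Let is_derive_fundamental (u w : tangent p) :
  is_derive (0 : R) 1
    (fun r : R => derive1 (fun s : R => L (tvec p (v + r *: u + s *: w))) 0)
    ('d (fun x => 'd Lc x (lift w)) z (lift u)).
Proof.
have [U [oU Uz] sL] := hL (dom_chart_at p).
have := is_derive_derive_line (lift u) (lift w) oU Uz (sL 2).
by congr (is_derive _ _ _ _); apply/funext => r; congr derive1;
  apply/funext => s; rewrite L_lineE.
Qed.

Lemma fundamental_tensor_derivable (u w : tangent p) : derivable
  (fun r : R => derive1 (fun s : R => L (tvec p (v + r *: u + s *: w))) 0) 0 1.
Proof. exact: (@ex_derive _ _ _ _ _ _ _ (is_derive_fundamental u w)). Qed.

Lemma smooth_derivable_line (w : tangent p) :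
  derivable (fun s : R => L (tvec p (v + s *: w))) 0 1.
Proof.
have [U [oU Uz] sL] := hL (dom_chart_at p).
have := @is_derive_line0 _ _ U Lc z 0 (lift w) (sL 2) 0.
rewrite scaler0 addr0 => /(_ Uz) /(@ex_derive _ _ _ _ _ _ _).
rewrite (_ : (fun _ => _) = fun s => L (tvec p (v + s *: w)))//.
apply/funext => s; have := L_lineE 0 w 0 s.
by rewrite !scale0r !addr0.
Qed.

(** In the chart the tensor is half a second differential evaluated at lifts: symmetric by
    [diff2_sym], and linear in the outer direction as any differential is. *)
Lemma fundamental_tensor_bilinear :
  symmetric_bilinear (fundamental_tensor L p v).
Proof.
have E u w : fundamental_tensor L p v u w =
    2^-1 * 'd (fun x => 'd Lc x (lift w)) z (lift u).
  rewrite /fundamental_tensor derive1E.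
  by rewrite (@derive_val _ _ _ _ _ _ _ (is_derive_fundamental u w)).
have [U [oU Uz] sL] := hL (dom_chart_at p).
split=> [u w|a u u' w].
  by rewrite !E; congr (_ * _); exact: (diff2_sym _ _ oU Uz (sL 2)).
set D : {linear _ -> R} := 'd (fun x => 'd Lc x (lift w)) z.
have DE x : fundamental_tensor L p v x w = 2^-1 * D (lift x) by exact: E.
have DL : D (lift (a *: u + u')) = a * D (lift u) + D (lift u').
  exact: (etrans (congr1 D (lift_linear a u u')) (linearP D a _ _)).
by rewrite !DE DL mulrDr; congr (_ + _); exact: mulrCA.
Qed.

End FundamentalTensor.

(** * Signature of the fundamental tensor of the cone function *)

Section ConeFundamentalTensor.
Context {R : realType} {n : nat} {M : smoothManifold R n}.
Variables (Om : forall p : M, {scalar tangent p}) (T : forall p : M, tangent p).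
Variable F : TM M -> R.
Arguments Om : clear implicits.
Hypothesis hT : cone_triple Om T F.
Variable G : TM M -> R.
Hypothesis hG : cone_function Om T F G.
Variables (p : M) (v : tangent p).
Hypothesis hv : TM_smooth_at (tvec p v) G.

Let OmT : Om p (T p) = 1 := triple_normalized hT p.

Let OmD (x y : tangent p) : Om p (x + y) = Om p x + Om p y.
Proof. exact: linearD. Qed.

Let OmZ a (x : tangent p) : Om p (a *: x) = a * Om p x.
Proof. exact: linearZ. Qed.

(** The variables separate: a multiple of [T] changes only the square of the form, a kernel vector
    only the [F] term. *)
Let G_line a (w : tangent p) : Om p w = 0 ->
  G (tvec p (v + a *: T p + w)) =
  (Om p v + a) ^+ 2 - F (tvec p (ker_part Om T v + w)) ^+ 2.
Proof.
move=> w0; rewrite (cone_functionE hT hG) !OmD OmZ OmT mulr1 w0 addr0.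
congr (_ - F (tvec p _) ^+ 2).
rewrite /ker_part !OmD OmZ OmT mulr1 w0 addr0 scalerDl.
by apply/rowP => k; rewrite !mxE; ring.
Qed.

Let Om_line a b (w : tangent p) : Om p w = 0 -> Om p (a *: w + b *: w) = 0.
Proof. by move=> w0; rewrite OmD !OmZ w0 !mulr0 addr0. Qed.

Lemma cone_tensor_TT : fundamental_tensor G p v (T p) (T p) = 1.
Proof.
have E r : derive1 (fun s => G (tvec p (v + r *: T p + s *: T p))) 0 =
    2 * (Om p v + r).
  set k := F (tvec p (ker_part Om T v)) ^+ 2.
  (* Along [T] the [F] term is the constant [k]; the signs are arranged to match
     [is_derive_quadratic]. *)
  rewrite (_ : (fun _ => _) = fun s => - k - (-1) * ((Om p v + r) + s) ^+ 2).
    have Q := is_derive_quadratic (-1) (- k) (Om p v + r) 0.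
    by rewrite derive1E (@derive_val _ _ _ _ _ _ _ Q); ring.
  apply/funext => s; have := G_line (r + s) (linear0 (Om p)).
  by rewrite !addr0 scalerDl addrA => ->; rewrite -/k; ring.
rewrite /fundamental_tensor (funext E) derive1E.
have Q := is_deriveZ 2 (is_deriveD (is_derive_cst (Om p v) (0 : R) 1)
  (is_derive_id (0 : R) 1)).
rewrite (@derive_val _ _ _ _ _ _ _ Q) /GRing.scale/= add0r mulr1.
by rewrite mulVf.
Qed.

(** The step along [T] enters as an additive constant in [s], so the inner derivative does not
    depend on [r] and the outer one vanishes. *)
Lemma cone_tensor_Tker (w : tangent p) : Om p w = 0 ->
  fundamental_tensor G p v (T p) w = 0.
Proof.
move=> w0.
have E r : derive1 (fun s => G (tvec p (v + r *: T p + s *: w))) 0 =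
    - derive1 (fun s => F (tvec p (ker_part Om T v + s *: w)) ^+ 2) 0.
  rewrite -(derive1_subl ((Om p v + r) ^+ 2)); congr derive1.
  by apply/funext => s; rewrite G_line// OmZ w0 mulr0.
by rewrite /fundamental_tensor (funext E) derive1_cst mulr0.
Qed.

Lemma cone_tensor_ker (w : tangent p) : Om p w = 0 -> w != 0 ->
  fundamental_tensor G p v w w < 0.
Proof.
move=> w0 wn0.
have [k0|kn0] := eqVneq (ker_part Om T v : 'rV[R]_n) 0; last first.
  have := finsler_convex (triple_finsler hT) (ker_part_ker hT v) kn0 w0 wn0.
  (* The minus sign is moved through both derivatives, with constant 0 in the outer one and
     [Om p v ^+ 2] in the inner one. *)
  rewrite -oppr_lt0; congr (_ < 0); rewrite /fundamental_tensor -mulrN.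
  congr (_ * _); rewrite -(derive1_subl 0); congr derive1; apply/funext => r.
  rewrite sub0r -(derive1_subl (Om p v ^+ 2)); congr derive1; apply/funext => s.
  have := G_line 0 (Om_line r s w0); rewrite scale0r !addr0 !addrA => ->.
  by [].
have Fw0 : 0 < F (tvec p w) by exact: (finsler_gt0 (triple_finsler hT)).
have FZ := fun l => finsler_homogeneous (triple_finsler hT) (l := l) w0.
(* Homogeneity with factor 2 at the zero vector says that this value equals its double. *)
have F0 : F (tvec p 0) = 0.
  have := finsler_homogeneous (triple_finsler hT) (linear0 (Om p)) (ltr0Sn R 1).
  by rewrite scaler0 => /eqP; rewrite -subr_eq0 -[X in X - _]mul1r -mulrBl mulf_eq0
    => /orP[|/eqP//]; rewrite opprD addrA subrr add0r oppr_eq0 oner_eq0.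
(* Homogeneity is only positive, so [F] may differ at [w] and [- w], and the quadratic formula for
   [f] is available for [x >= 0] alone. *)
pose f x := G (tvec p (v + x *: w)).
have fE x : 0 <= x -> f x = Om p v ^+ 2 - F (tvec p w) ^+ 2 * x ^+ 2.
  move=> x0; have xw0 : Om p (x *: w) = 0 by rewrite OmZ w0 mulr0.
  rewrite /f; have := G_line 0 xw0; rewrite scale0r !addr0 k0 add0r => ->.
  congr (_ - _); move: x0; rewrite le_eqVlt => /orP[/eqP <-|/FZ ->].
    by rewrite scale0r F0; ring.
  by ring.
have Ef : (fun r => derive1 (fun s => G (tvec p (v + r *: w + s *: w))) 0) =
    (fun r => derive1 (fun s => f (r + s)) 0).
  apply/funext => r; congr derive1; apply/funext => s.
  by rewrite /f scalerDl addrA.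
have ddf : derivable (fun r => derive1 (fun s => f (r + s)) 0) 0 1.
  by rewrite -Ef; exact: fundamental_tensor_derivable.
have df : derivable f 0 1 by exact: smooth_derivable_line.
rewrite /fundamental_tensor Ef (second_derive_right fE df ddf).
by rewrite mulrN mulKf// oppr_lt0 exprn_gt0.
Qed.

End ConeFundamentalTensor.

Theorem proposition5p1 (R : realType) (n : nat) (hn : (2 <= n)%N)
    (M : smoothManifold R n) (C : set (TM M))
    (Om : forall p : M, {scalar tangent p})
    (T : forall p : M, tangent p) (F : TM M -> R)
    (hT : cone_triple Om T F) (hC : cone_structure Om T F = C) :
  (exists! G : TM M -> R, cone_function Om T F G) /\
  forall G : TM M -> R, cone_function Om T F G ->
    [/\ TM_continuous_on setT G,
        two_homogeneous G,
        (forall v : TM M, ~ span_field T v -> TM_smooth_at v G) &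
        forall (p : M) (v : tangent p), TM_smooth_at (tvec p v) G ->
          [/\ symmetric_bilinear (fundamental_tensor G p v),
              nondegenerate_form (fundamental_tensor G p v) &
              lorentzian_signature n (fundamental_tensor G p v)]].
Proof.
split.
  (* The witness is forced by [cone_functionE]. *)
  exists (fun v => Om (projT1 v) (projT2 v) ^+ 2 -
    F (tvec (projT1 v) (ker_part Om T (projT2 v))) ^+ 2); split.
    move=> p t w w0 /=.
    have OmE : Om p (t *: T p + w) = t.
      have -> : Om p (t *: T p + w) = t * Om p (T p) + Om p w by exact: linearP.
      by rewrite (triple_normalized hT) w0 mulr1 addr0.
    by rewrite /ker_part OmE addrAC subrr add0r.
  by move=> G hG; apply/funext => -[p v]; rewrite (cone_functionE hT hG).
move=> G hG; split.
- exact: (cone_function_continuous hT hG).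
- exact: (cone_function_homogeneous hT hG).
- exact: (cone_function_smooth_at hT hG).
move=> p v hv.
have sb := fundamental_tensor_bilinear hv.
have TT := cone_tensor_TT hT hG v.
have Tk w : Om p w = 0 -> fundamental_tensor G p v (T p) w = 0.
  exact: (cone_tensor_Tker hT hG).
have kk w : Om p w = 0 -> w != 0 -> fundamental_tensor G p v w w < 0.
  exact: (cone_tensor_ker hT hG hv).
have OT := triple_normalized hT p.
split=> //.
  exact: (lorentz_nondegenerate sb OT TT Tk kk).
apply: (lorentz_signature sb OT TT Tk kk).
by rewrite dimvf dim_matrix mul1r.
Qed.
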